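(* Let $k\in\mathbb{N}$. \begin{enumerate} \item There is a constant $C_k$ such that for any set $P$ of $n_1$ points in $\mathbb{R}^2$ and any set $R$ of $n_2$ boxes in $\mathbb{R}^2$, if the incidence graph on $P\times R$ is $K_{k,k}$-free, then the number of incidences is at most $C_k\, n\log^4(n)$, where $n=n_1+n_2$. \item There is a constant $C'_k$ such that, if in addition all boxes in $R$ are dyadic, then the number of incidences is at most $C'_k\, n\frac{\log(100+n_1)}{\log\log(100+n_1)}$. \item There is a constant $c>0$ such that for arbitrarily large $n$ there exist a set of $n$ points and a set of $n$ dyadic boxes in $\mathbb{R}^2$ whose incidence graph is $K_{2,2}$-free and has at least $c\, n\frac{\log n}{\log\log n}$ incidences. \end{enumerate}
   Context: A box in $\mathbb{R}^d$ is a solid box with axis-parallel sides, i.e. a product $I_1\times\dots\times I_d$ of intervals (open or closed). A dyadic interval is a half-open interval $[s2^t,(s+1)2^t)$ with $s,t\in\mathbb{Z}$, and a dyadic box is a product of dyadic intervals. The incidence graph on $P\times R$ is the bipartite graph in which $p\in P$ is joined to $\rho\in R$ iff $p\in\rho$; an incidence is an edge of this graph. A bipartite graph is $K_{k,k}$-free if there are no $k$ vertices on one side and $k$ on the other side with all $k^2$ pairs being edges. *)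

(* Defs.v *)
From HB Require Import structures.
From mathcomp Require Import all_boot all_order all_algebra finmap.
From mathcomp Require Import all_classical all_reals all_analysis.

Set Implicit Arguments.
Unset Strict Implicit.
Unset Printing Implicit Defensive.

Import Order.TTheory GRing.Theory Num.Theory.
Local Open Scope classical_set_scope.
Local Open Scope fset_scope.
Local Open Scope ring_scope.

(* Points of R^d are row vectors; boxes are sets of points, so that a finite
   set of boxes never counts twice a box having two presentations. *)
Definition itv_prod (R : realType) (d : nat) (I : 'I_d -> interval R) :
    set 'rV[R]_d :=
  [set x | forall i, x ord0 i \in I i].

(* Each end of each side may independently be open, closed or infinite; in
   particular dyadic boxes, whose sides are half-open, are boxes. *)
Definition is_box (R : realType) (d : nat) (B : set 'rV[R]_d) : Prop :=
  exists I : 'I_d -> interval R, B = itv_prod I.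

Definition is_dyadic_itv (R : realType) (I : interval R) : Prop :=
  exists s t : int, I = `[s%:~R * 2 ^ t, (s + 1)%:~R * 2 ^ t[.

Definition is_dyadic_box (R : realType) (d : nat) (B : set 'rV[R]_d) : Prop :=
  exists2 I : 'I_d -> interval R,
    (forall i, is_dyadic_itv (I i)) & B = itv_prod I.

(* The edge set of the incidence graph on P x Bs. *)
Definition incidences (T : choiceType) (P : {fset T}) (Bs : {fset (set T)}) :
    {fset T * set T} :=
  [fset e in P `*` Bs | e.1 \in e.2].

Definition Kkk_free (T U : choiceType) (k : nat)
    (X : {fset T}) (Y : {fset U}) (E : {fset T * U}) : Prop :=
  ~ exists (X' : {fset T}) (Y' : {fset U}),
      [/\ (X' `<=` X)%fset, (Y' `<=` Y)%fset, #|` X'| = k, #|` Y'| = k &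
          forall x y, x \in X' -> y \in Y' -> (x, y) \in E].

(* Main.v *)
Require Import Defs.
From HB Require Import structures.
From mathcomp Require Import all_boot all_order all_algebra finmap.
From mathcomp Require Import all_classical all_reals all_analysis.
From mathcomp Require Import zify ring lra.

Set Implicit Arguments.
Unset Strict Implicit.
Unset Printing Implicit Defensive.

Import Order.TTheory GRing.Theory Num.Theory.
(* Makes the finite-set lemmas win over their classical_sets homonyms. *)
Import mathcomp.boot.fintype mathcomp.boot.finset.

(** Boxes (1).  If all boxes of a family span the x-range of a set V of points, only the
    y-intervals matter.  Discard from every interval its k highest points; if a point p
    survives in the intervals of a family, the shortest of them above p has k points, all
    common to the family, so the family has fewer than k members.  This gives the linear
    bound k (|V| + |W|).  Halving the point set by x-coordinate log n times, each of the two
    x-ends of a box separates one piece per level, so O(k n log n) holds in general, which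
    is stronger than the claim.

    Dyadic boxes (2).  A box with at least k points is included in fewer than k boxes, so
    after splitting into k classes the boxes through a point are linearly ordered: the wider
    the flatter.  Prune h times: at each point drop the k widest boxes, then drop the boxes
    left with fewer than k a points.  This loses h k n1 + k a n2 incidences.  The y-side of
    a box surviving j rounds contains a^j points: its k a points lie in boxes of the
    previous round, so flat that each meets at most k of them, which gives a disjoint
    y-sides with a^(j-1) points each.  Hence nothing survives once a^h > n1, and a, h
    can be taken of order log n1 / log log n1.

    Lower bound (3).  Let a be a power of 2 and take the words of length a over a letters,
    with the base-a numbers spelled by the reversed word and by the word as coordinates.
    Fixing all letters but the i-th fixes the leading digits of both coordinates, so lines of
    the Hamming graph are cut out by dyadic boxes; two points lie on at most one line. *)

(** * Finite families of sets: double counting and extremal elements *)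

Definition biclique_free (T U : finType) (k : nat) (A : U -> {set T}) : Prop :=
  forall (V : {set T}) (W : {set U}),
    {in W, forall u, V \subset A u} -> (#|V| < k) || (#|W| < k).

Lemma double_count (T U : finType) (W : {set U}) (F : U -> {set T}) :
  \sum_(u in W) #|F u| = \sum_p #|[set u in W | p \in F u]|.
Proof.
under eq_bigr do rewrite -sum1_card.
rewrite (exchange_big_dep predT) //=; apply: eq_bigr => p _.
by rewrite -sum1_card; apply: eq_bigl => u; rewrite inE.
Qed.

Lemma ex_minimal (T : finType) d (K : orderType d) (f : T -> K)
    (S : {set T}) (p0 : T) :
  p0 \in S -> exists2 p, p \in S & forall t, t \in S -> (f p <= f t)%O.
Proof.
move=> Sp0.
by case: (@Order.TotalTheory.arg_minP _ _ _ p0 (fun p => p \in S) f Sp0) => p; exists p.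
Qed.

Lemma ex_maximal (T : finType) (f : T -> nat) (S : {set T}) (p0 : T) :
  p0 \in S -> exists2 p, p \in S & forall t, t \in S -> f t <= f p.
Proof.
by move=> Sp0; case: (@arg_maxnP _ p0 (fun p => p \in S) f Sp0) => p; exists p.
Qed.

(** The whole filtered set lies above its [f]-lowest member, which by choice has fewer than [k]
    elements of [S] above it. This serves both for the highest points of an interval and for the
    widest boxes at a point. *)
Lemma card_few_above (T : finType) d (K : orderType d) (f : T -> K)
    (S : {set T}) (k : nat) :
  #|[set p in S | #|[set t in S | (f p <= f t)%O]| < k]| <= k.
Proof.
set L := [set p in S | _].
have [->|[p0 Lp0]] := set_0Vmem L; first by rewrite cards0.
have [p Lp pmin] := ex_minimal f Lp0.
move: (Lp); rewrite inE => /andP[_ /ltnW]; apply: leq_trans.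
apply/subset_leq_card/subsetP => t Lt; rewrite inE pmin // andbT.
by move: Lt; rewrite inE => /andP[].
Qed.

(** * Arbitrary boxes: the interval bound and halving by x-coordinate *)

Lemma interval_incidences (T U : finType) d (K : orderType d) (y : T -> K)
    (k : nat) (A B : U -> {set T}) (V : {set T}) (W : {set U}) :
  biclique_free k A ->
  {in W, forall u, B u \subset A u :&: V} ->
  (forall p u v, p \in B u -> p \in B v ->
     let up w := [set t in B w | (y p <= y t)%O] in
     (up u \subset up v) || (up v \subset up u)) ->
  \sum_(u in W) #|B u| <= k * (#|V| + #|W|).
Proof.
move=> free subB chain.
(* Two intervals through [p] can differ above [p] only in their upper ends; [chain] records exactly
   this. *)
pose up p u := [set t in B u | (y p <= y t)%O].
pose low u := [set p in B u | #|up p u| < k].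
pose high u := [set p in B u | k <= #|up p u|].
have -> : \sum_(u in W) #|B u| = \sum_(u in W) #|low u| + \sum_(u in W) #|high u|.
  rewrite -big_split /=; apply: eq_bigr => u _.
  rewrite -(cardsID (low u) (B u)); congr (_ + _); apply: eq_card => p.
    by rewrite !inE; case: (p \in B u).
  by rewrite !inE; case: (p \in B u); rewrite ?andbF //= andbT -leqNgt.
(* Low incidences are counted per interval, high ones per point. *)
rewrite mulnDr addnC leq_add //; last first.
  rewrite mulnC -sum_nat_const; apply: leq_sum => u _; exact: card_few_above.
rewrite double_count (bigID (mem V)) /= [X in _ + X]big1 ?addn0 => [|p pNV].
  rewrite mulnC -sum_nat_const; apply: leq_sum => p _.
  set H := [set u in W | _].
  have [->|[u0 Hu0]] := set_0Vmem H; first by rewrite cards0.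
  have [u Hu umin] := ex_minimal (fun u => #|up p u|) Hu0.
  have sub v : v \in H -> up p u \subset up p v.
    move=> Hv; move: (Hu) (Hv); rewrite !inE => /andP[_ /andP[pu _]] /andP[_ /andP[pv _]].
    move: (chain _ _ _ pu pv) => /= /orP[//|sub'].
    by have /eqP -> : up p v == up p u by rewrite eqEcard sub'; exact: umin.
  suff /free/orP[|/ltnW //] : {in H, forall v, up p u \subset A v}.
    by move: Hu; rewrite !inE ltnNge => /andP[_ /andP[_ ->]].
  move=> v Hv; apply: subset_trans (sub v Hv) _.
  apply/subsetP => t; rewrite inE => /andP[tB _].
  have := Hv; rewrite inE => /andP[/subB /subsetP/(_ _ tB)].
  by rewrite inE => /andP[].
apply/eqP; rewrite cards_eq0 -subset0; apply/subsetP => u.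
rewrite !inE => /andP[/subB /subsetP/(_ p) sub /andP[/sub]].
by rewrite inE (negbTE pNV) andbF.
Qed.

(** Taking [x]-minimal elements one at a time reaches any exact size even when many points share a
    coordinate, at the price of a weak inequality between the parts. *)
Lemma lower_part (T : finType) d (K : orderType d) (x : T -> K)
    (V : {set T}) (m : nat) :
  m <= #|V| -> exists V1 : {set T},
    [/\ V1 \subset V, #|V1| = m &
        forall s t, s \in V1 -> t \in V :\: V1 -> (x s <= x t)%O].
Proof.
elim: m => [|m IHm] leV.
  by exists set0; rewrite sub0set cards0; split=> // s t; rewrite inE.
have [V1 [V1V cV1 le1]] := IHm (ltnW leV).
have [E|[p0 Dp0]] := set_0Vmem (V :\: V1).
  by have := cardsID V1 V; rewrite E cards0 (setIidPr V1V) cV1; lia.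
have [p Dp pmin] := ex_minimal x Dp0.
move: (Dp); rewrite inE => /andP[pNV1 pV].
exists (p |: V1); split.
- by rewrite subUset sub1set pV V1V.
- by rewrite cardsU1 pNV1 cV1.
- move=> s t /setU1P[->|sV1]; rewrite !inE negb_or -andbA => /and3P[tNp tN1 tV].
    by apply: pmin; rewrite inE tN1.
  by apply: le1; rewrite // inE tN1.
Qed.

(** For [S] the half-plane beyond one end of a box, this says that the end cuts through the piece
    [V]. *)
Definition splits (T : finType) (S V : {set T}) : bool :=
  (V :&: S != set0) && (V :\: S != set0).

Lemma splitsPn (T : finType) (S V : {set T}) :
  ~~ splits S V -> (V :&: S = set0) \/ (V \subset S).
Proof. by rewrite negb_and !negbK setD_eq0 => /orP[/eqP|]; [left|right]. Qed.

Lemma splitsC (T : finType) (S V : {set T}) : splits (~: S) V = splits S V.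
Proof. by rewrite /splits !setDE setCK andbC. Qed.

Lemma splitsS (T : finType) (S V V' : {set T}) :
  V \subset V' -> splits S V -> splits S V'.
Proof.
move=> sub /andP[/set0Pn[s sV] /set0Pn[t tV]].
apply/andP; split; apply/set0Pn.
  by exists s; apply: subsetP (setSI _ sub) _ sV.
by exists t; apply: subsetP (setSD _ sub) _ tV.
Qed.

(** An up-closed [S] meeting the lower half contains the whole upper half, so an end cuts at most
    one half. *)
Lemma splits_halves (T : finType) d (K : porderType d) (x : T -> K)
    (S V1 V2 : {set T}) :
  (forall s t, s \in V1 -> t \in V2 -> (x s <= x t)%O) ->
  (forall s t, (x s <= x t)%O -> s \in S -> t \in S) ->
  splits S V1 + splits S V2 <= splits S (V1 :|: V2).
Proof.
move=> le12 Sup.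
case s1: (splits S V1); case s2: (splits S V2) => //=.
- move: s1 s2 => /andP[/set0Pn[s]]; rewrite inE => /andP[sV sS] _.
  move=> /andP[_ /set0Pn[t]]; rewrite inE => /andP[/negP tS tV].
  by case: tS; apply: Sup (le12 _ _ sV tV) sS.
- by rewrite (splitsS (subsetUl _ _) s1).
- by rewrite (splitsS (subsetUr _ _) s2).
Qed.

(** Here [L u] lies beyond the left end of the box, [D u] before its right end, [J u] is its
    y-range, and [w u V] counts the ends cutting [V]. Only cut boxes go down to the halves. There
    they are full on at most two pieces, which the additional [2 * w u V] of each level pays for,
    and by [splits_halves] the total of [w] does not grow. *)
Lemma box_incidences_rec (T U : finType) d (K : orderType d) (x y : T -> K)
    (k : nat) (A L D J : U -> {set T}) :
  biclique_free k A ->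
  (forall u, A u = L u :&: D u :&: J u) ->
  (forall u s t, (x s <= x t)%O -> s \in L u -> t \in L u) ->
  (forall u s t, (x s <= x t)%O -> t \in D u -> s \in D u) ->
  (forall (V : {set T}) p u v, p \in J u -> p \in J v ->
     let up w := [set t in V :&: J w | (y p <= y t)%O] in
     (up u \subset up v) || (up v \subset up u)) ->
  let w u V := splits (L u) V + splits (D u) V in
  forall h (V : {set T}) (W : {set U}), #|V| <= 2 ^ h ->
  \sum_(u in W) #|V :&: A u| <= k * h.+1 * #|V| +
     \sum_(u in W) k * ((V \subset L u :&: D u) + 2 * h * w u V).
Proof.
move=> free defA Lup Ddown chain w.
pose full u (V : {set T}) := V \subset L u :&: D u.
have level (V : {set T}) (W : {set U}) :
  \sum_(u in W) #|V :&: A u| <= k * #|V| + \sum_(u in W) k * full u V +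
     \sum_(u in W | 0 < w u V) #|V :&: A u|.
  rewrite (bigID (fun u => full u V)) /= leq_add //.
    have -> : \sum_(u in W) k * full u V = k * #|[set u in W | full u V]|.
      rewrite -big_distrr /= -sum1_card; congr (_ * _).
      rewrite big_mkcond [RHS]big_mkcond; apply: eq_bigr => u _; rewrite inE.
      by case: (u \in W) => //=; case: (full u V).
    rewrite -mulnDr.
    apply: leq_trans (@interval_incidences _ _ _ _ y k A (fun u => V :&: J u) V _ free _ _).
    - rewrite (eq_bigl (fun u => u \in [set u in W | full u V])) => [|u]; last by rewrite inE.
      by apply: leq_sum => u _; rewrite subset_leq_card // setIS // defA subsetIr.
    - move=> u; rewrite inE => /andP[_ /subsetP fullu].
      apply/subsetP => t; rewrite defA !inE => /andP[tV ->].
      by have := fullu _ tV; rewrite inE => ->; rewrite tV.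
    - by move=> p u v; rewrite !in_setI => /andP[_ pu] /andP[_ pv]; exact: chain.
  (* A box that is not full and has no end cutting [V] misses [V] in the x-direction. *)
  rewrite [leqLHS]big_mkcond [leqRHS]big_mkcond; apply: leq_sum => u _ /=.
  case: (u \in W) => //=; case: ifP => // nfull; case: ifP => //.
  move/negbT; rewrite -leqNgt leqn0 addn_eq0 !eqb0 => /andP[/splitsPn nL /splitsPn nD].
  rewrite leqn0 cards_eq0 -subset0.
  case: nL => [<-|LV]; first by rewrite defA -setIA setIS // subsetIl.
  case: nD => [<-|DV]; first by rewrite defA -setIA setIS // setICA subsetIl.
  by move: nfull; rewrite /full subsetI LV DV.
elim=> [|h IHh] V W cV.
  rewrite muln1; apply: leq_trans (level V W) _.
  rewrite [X in _ + X]big1 ?addn0 ?leq_add2l => [|u /andP[_]].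
    by apply: leq_sum => u _; rewrite muln0 mul0n addn0.
  suff nsp S : splits S V = false by rewrite /w !nsp.
  apply/negbTE/negP => /andP[/set0Pn[s]]; rewrite inE => /andP[sV sS].
  move=> /set0Pn[t]; rewrite inE => /andP[/negP tS tV].
  by case: tS; rewrite (card_le1_eqP cV s t sV tV).
(* If [V] has at most [2 ^ h] points, the minimum makes [V1] all of [V] and [V2] empty. *)
have [V1 [V1V cV1 le12]] := @lower_part _ _ _ x V (minn (2 ^ h) #|V|) (geq_minr _ _).
set V2 := V :\: V1 in le12.
have defV : V1 :|: V2 = V by rewrite -[RHS](setID V V1) (setIidPr V1V).
have cV2 : #|V1| + #|V2| = #|V| by rewrite -(cardsID V1 V) (setIidPr V1V).
have [c1 c2] : #|V1| <= 2 ^ h /\ #|V2| <= 2 ^ h by move: cV; rewrite expnS; lia.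
apply: leq_trans (level V W) _.
pose W' := [set u in W | 0 < w u V].
have -> : \sum_(u in W | 0 < w u V) #|V :&: A u| =
    \sum_(u in W') #|V1 :&: A u| + \sum_(u in W') #|V2 :&: A u|.
  rewrite -big_split /= (eq_bigl (fun u => u \in W')) => [|u]; last by rewrite inE.
  apply: eq_bigr => u _.
  rewrite -(cardsID V1 (V :&: A u)); congr (_ + _); apply: eq_card => t; rewrite !inE.
    by case: (boolP (t \in V1)) => [/(subsetP V1V) ->|]; rewrite ?andbT ?andbF.
  by rewrite andbA.
apply: leq_trans (leq_add (leqnn _) (leq_add (IHh V1 W' c1) (IHh V2 W' c2))) _.
rewrite [X in _ + X]addnACA -big_split /= -mulnDr cV2 addnACA leq_add //.
  by rewrite -mulnDl -[X in X + _]muln1 -mulnDr.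
apply: (@leq_trans (\sum_(u in W) k * full u V + \sum_(u in W) k * (2 * h.+1 * w u V))).
  rewrite leq_add2l (eq_bigl (fun u => (u \in W) && (0 < w u V))) => [|u]; last by rewrite inE.
  rewrite [leqLHS]big_mkcondr /=; apply: leq_sum => u _; case: ifP => // w0.
  rewrite -mulnDr leq_mul2l; apply/orP; right.
  have wL : splits (L u) V1 + splits (L u) V2 <= splits (L u) V.
    by rewrite -defV; apply: (splits_halves le12); exact: Lup.
  have wD : splits (D u) V1 + splits (D u) V2 <= splits (D u) V.
    rewrite -!(splitsC (D u)) -defV; apply: (splits_halves le12) => s t st.
    by rewrite !inE; apply: contra; exact: Ddown.
  have w12 : w u V1 + w u V2 <= w u V by rewrite /w; lia.
  have := leq_mul (leqnn (2 * h)) w12; move: w0; rewrite -/(full u V1) -/(full u V2).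
  case: (full u V1); case: (full u V2) => /=; nia.
by rewrite -big_split /=; apply: leq_sum => u _; rewrite mulnDr.
Qed.

Lemma box_incidences (T U : finType) d (K : orderType d) (x y : T -> K)
    (k : nat) (A L D J : U -> {set T}) (h : nat) :
  biclique_free k A ->
  (forall u, A u = L u :&: D u :&: J u) ->
  (forall u s t, (x s <= x t)%O -> s \in L u -> t \in L u) ->
  (forall u s t, (x s <= x t)%O -> t \in D u -> s \in D u) ->
  (forall (V : {set T}) p u v, p \in J u -> p \in J v ->
     let up w := [set t in V :&: J w | (y p <= y t)%O] in
     (up u \subset up v) || (up v \subset up u)) ->
  #|T| <= 2 ^ h -> \sum_u #|A u| <= k * (4 * h).+1 * (#|T| + #|U|).
Proof.
move=> free defA Lup Ddown chain; rewrite -cardsT => cT.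
have := @box_incidences_rec _ _ _ _ x y k A L D J free defA Lup Ddown chain h _ [set: U] cT.
rewrite -[#|U|]cardsT.
under eq_bigr do rewrite setTI.
under [\sum_u #|_|]eq_bigl => u do rewrite -(in_setT u).
move/leq_trans; apply; rewrite mulnDr leq_add //.
  by rewrite leq_mul2r leq_mul2l; apply/orP; right; apply/orP; right; lia.
rewrite [leqRHS]mulnC -sum_nat_const; apply: leq_sum => u _.
rewrite leq_mul2l; apply/orP; right.
(* Both ends cutting gives the worst case [1 + 2 * h * 2]. *)
by case: (_ \subset _); case: (splits _ _); case: (splits _ _) => /=; lia.
Qed.

(** * Dyadic boxes: laminar sides and pruning rounds *)

Definition laminar (I T : finType) (B : I -> {set T}) : Prop :=
  forall i j, [|| B i \subset B j, B j \subset B i | [disjoint B i & B j]].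

(** Greedy choice: the largest [B q] contains at most [k] points of [Q]. By laminarity and
    maximality, [B r] is disjoint from it for every [r] of [Q] outside it, so induction applies to
    the rest. *)
Lemma laminar_cover (T : finType) (Q : {set T}) (B : T -> {set T}) (k M : nat) :
  {in Q, forall q, q \in B q} ->
  {in Q &, forall q r, [|| B q \subset B r, B r \subset B q | [disjoint B q & B r]]} ->
  {in Q, forall q, #|Q :&: B q| <= k} ->
  {in Q, forall q, M <= #|B q|} ->
  #|Q| * M <= k * #|\bigcup_(q in Q) B q|.
Proof.
move Dn: #|Q| => n; elim/ltn_ind: n Q Dn => n IHn Q cQ inB lam small large.
have [E|[q0 Qq0]] := set_0Vmem Q; first by rewrite -cQ E cards0.
have [q Qq qmax] := ex_maximal (fun q => #|B q|) Qq0.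
pose Q' := Q :\: B q.
have cQ' : #|Q| = #|Q :&: B q| + #|Q'| by rewrite cardsID.
have subQ r : r \in Q' -> r \in Q by rewrite inE => /andP[].
have disj r : r \in Q' -> [disjoint B q & B r].
  move=> Q'r; have Qr := subQ _ Q'r.
  have rB : r \notin B q by move: Q'r; rewrite inE => /andP[].
  case/or3P: (lam _ _ Qq Qr) => // sub.
    have /eqP E : B q == B r by rewrite eqEcard sub; exact: qmax.
    by rewrite E inB in rB.
  by rewrite (subsetP sub) ?inB in rB.
have qpos : 0 < #|Q :&: B q| by apply/card_gt0P; exists q; rewrite inE Qq inB.
have IH : #|Q'| * M <= k * #|\bigcup_(r in Q') B r|.
  apply: (IHn #|Q'|) => //; first by rewrite -cQ cQ'; lia.
  - by move=> r /subQ; exact: inB.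
  - by move=> r s /subQ Qr /subQ; exact: lam.
  - move=> r /subQ Qr; apply: leq_trans (small r Qr).
    by rewrite subset_leq_card // setSI // subsetDl.
  - by move=> r /subQ; exact: large.
have cU : #|B q| + #|\bigcup_(r in Q') B r| <= #|\bigcup_(r in Q) B r|.
  have d : [disjoint B q & \bigcup_(r in Q') B r].
    exact/bigcup_disjointP.
  have /eqP <- : #|B q :|: \bigcup_(r in Q') B r| == #|B q| + #|\bigcup_(r in Q') B r|.
    by rewrite (leq_card_setU _ _).
  apply/subset_leq_card; rewrite subUset bigcup_sup //; apply/bigcupsP => r /subQ Qr.
  exact: bigcup_sup.
rewrite -cQ cQ' mulnDl; apply: leq_trans (leq_mul (leqnn k) cU); rewrite mulnDr.
by rewrite leq_add // leq_mul // ?small ?large.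
Qed.

Section Crossing.
Variables (T U : finType) (k a : nat) (X Y F : U -> {set T}).
Hypothesis free : biclique_free k (fun u => X u :&: Y u).
Hypothesis lamY : laminar Y.
Hypothesis subF : forall u, F u \subset X u :&: Y u.
Hypothesis cross : forall p u v, p \in F u -> p \in F v -> #|X u| <= #|X v| ->
  X u \subset X v /\ Y v \subset Y u.

(** A round loses at most [k] incidences per point. The last sum charges [k * a] to each emptied
    box, once for all rounds because it stays empty. *)
Lemma prune_rounds (j : nat) : exists G : U -> {set T},
  [/\ (forall u, G u \subset F u),
      \sum_u #|F u| <= \sum_u #|G u| + j * k * #|T| + \sum_u k * a * (G u == set0) &
      forall p u, p \in G u -> a ^ j <= #|Y u|].
Proof.
(* For [k = 0] the empty biclique contradicts freeness. *)
have k0 : 0 < k.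
  have := @free set0 set0; rewrite !cards0 orbb; apply.
  by move=> u; rewrite inE.
have FY p u : p \in F u -> p \in Y u by move/(subsetP (subF u)); rewrite inE => /andP[].
have FX p u : p \in F u -> p \in X u by move/(subsetP (subF u)); rewrite inE => /andP[].
elim: j => [|j [G [GF cG GY]]].
  exists F; split=> //; first by rewrite !mul0n addn0 leq_addr.
  by move=> p u pu; rewrite expn0; apply/card_gt0P; exists p; exact: FY.
pose wider p u := [set v | (p \in G v) && (#|X u| <= #|X v|)].
pose G1 u := [set p in G u | k <= #|wider p u|].
pose G2 u := if k * a <= #|G1 u| then G1 u else set0.
have G1G u : G1 u \subset G u by apply/subsetP => p; rewrite inE => /andP[].
have G21 u : G2 u \subset G1 u by rewrite /G2; case: ifP; rewrite ?sub0set.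
exists G2; split.
- by move=> u; apply: subset_trans (G21 u) (subset_trans (G1G u) (GF u)).
- apply: leq_trans cG _.
  have cG1 : \sum_u #|G u| <= \sum_u #|G1 u| + k * #|T|.
    have -> : \sum_u #|G u| = \sum_u #|G1 u| + \sum_u #|G u :\: G1 u|.
      rewrite -big_split; apply: eq_bigr => u _ /=.
      by rewrite -(cardsID (G1 u) (G u)) (setIidPr (G1G u)).
    rewrite leq_add2l.
    under eq_bigl => u do rewrite -(in_setT u).
    rewrite double_count mulnC -sum_nat_const; apply: leq_sum => p _.
    apply: leq_trans (card_few_above (fun u => #|X u|) [set u | p \in G u] k).
    apply/subset_leq_card/subsetP => u; rewrite !inE negb_and -ltnNge.
    case: (p \in G u) => //=; rewrite ?andbF // andbT.
    by congr (_ < _); apply: eq_card => v; rewrite !inE.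
  have cG2 : \sum_u #|G1 u| + \sum_u k * a * (G u == set0) <=
             \sum_u #|G2 u| + \sum_u k * a * (G2 u == set0).
    rewrite -!big_split /=; apply: leq_sum => u _; rewrite /G2.
    case: (leqP (k * a) #|G1 u|) => [_|lt].
      rewrite leq_add2l leq_mul2l; apply/orP; right.
      by case: eqP => // E; rewrite -subset0 -E G1G.
    rewrite eqxx cards0 muln1 add0n.
    case: eqP => [E|_]; last by rewrite muln0 addn0 ltnW.
    by rewrite muln1 (_ : #|G1 u| = 0) //; apply/eqP; rewrite cards_eq0 -subset0 -E G1G.
  by rewrite mulSn mulnDl; lia.
move=> p u; rewrite /G2; case: ifP => [large _|]; last by rewrite inE.
(* By [cross], this intersection is the y-side of the widest box of [wider q u]. *)
pose B q := \bigcap_(v in wider q u) Y v.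
have G1F q : q \in G1 u -> q \in F u by move/(subsetP (G1G u))/(subsetP (GF u)).
have BP q : q \in G1 u -> exists2 v, v \in wider q u & B q = Y v.
  move=> Qq; have : 0 < #|wider q u|.
    by apply: leq_trans k0 _; move: Qq; rewrite inE => /andP[].
  case/card_gt0P => v0 Vv0.
  have [v Vv vmax] := ex_maximal (fun v => #|X v|) Vv0; exists v => //.
  apply/eqP; rewrite eqEsubset; apply/andP; split; first exact: bigcap_inf.
  apply/bigcapsP => w Vw.
  move: (Vv) (Vw); rewrite !inE => /andP[qv _] /andP[qw _].
  by case: (cross (subsetP (GF w) _ qw) (subsetP (GF v) _ qv) (vmax _ Vw)).
(* The [k * a] points of [G1 u], each with a y-side of size at least [a ^ j], are packed into [Y u]
   with loss factor [k], which cancels. *)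
rewrite -(leq_pmul2l k0) expnS mulnA.
apply: leq_trans (leq_mul large (leqnn (a ^ j))) _.
apply: leq_trans (@laminar_cover T (G1 u) B k (a ^ j) _ _ _ _) _.
- move=> q Qq; have [v + ->] := BP q Qq; rewrite inE => /andP[qv _].
  exact/FY/(subsetP (GF v)).
- move=> q r /BP[v _ ->] /BP[w _ ->]; exact: lamY.
- move=> q Qq; have [v Vv E] := BP q Qq.
  (* [X u :&: B q] is common to the at least [k] boxes of [wider q u], so it has fewer than [k]
     points. *)
  suff /free/orP[lt|] : {in wider q u, forall w, X u :&: B q \subset X w :&: Y w}.
  + apply: leq_trans (ltnW lt); apply/subset_leq_card/setSI/subsetP => r /G1F; exact: FX.
  + by move: Qq; rewrite inE ltnNge => /andP[_ ->].
  move=> w Vw; apply: setISS; last exact: bigcap_inf.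
  move: Vw; rewrite inE => /andP[qw leX].
  by case: (cross (G1F _ Qq) (subsetP (GF w) _ qw) leX).
- by move=> q /BP[v + ->]; rewrite inE => /andP[/GY].
- rewrite leq_mul2l; apply/orP; right; apply/subset_leq_card/bigcupsP => q Qq.
  have [v + ->] := BP q Qq; rewrite inE => /andP[qv leX].
  by case: (cross (G1F _ Qq) (subsetP (GF v) _ qv) leX).
Qed.

(** A point surviving [h] rounds would give a y-side with more points than [T] has, so only the
    losses remain. *)
Lemma crossing_incidences (h : nat) : #|T| < a ^ h ->
  \sum_u #|F u| <= h * k * #|T| + k * a * #|U|.
Proof.
move=> lth; have [G [_ cG GY]] := prune_rounds h.
have G0 u : #|G u| = 0.
  apply/eqP; rewrite cards_eq0 -subset0; apply/subsetP => p /GY le.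
  by have := leq_trans lth (leq_trans le (max_card _)); rewrite ltnn.
apply: leq_trans cG _; rewrite (eq_bigr _ (fun u _ => G0 u)) sum_nat_const muln0 add0n.
rewrite leq_add2l [leqRHS]mulnC -sum_nat_const; apply: leq_sum => u _.
by case: (_ == _); rewrite ?muln1 ?muln0.
Qed.
End Crossing.

(** Boxes with at least [k] points are classified by the number of boxes above them, which is below
    [k]; the others cost [k] each. Nested boxes have nested sets [above], so within a class these
    coincide, and boxes sharing a point satisfy the crossing hypothesis. *)
Lemma laminar_incidences (T U : finType) (k a h : nat) (X Y : U -> {set T}) :
  biclique_free k (fun u => X u :&: Y u) -> laminar X -> laminar Y ->
  #|T| < a ^ h ->
  \sum_u #|X u :&: Y u| <= k * #|U| + k * (h * k * #|T| + k * a * #|U|).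
Proof.
move=> free lamX lamY lth.
pose above u := [set v | (X u \subset X v) && (Y u \subset Y v)].
pose F (i : 'I_k) u := if #|above u| == i then X u :&: Y u else set0.
have split_u u : #|X u :&: Y u| <= k + \sum_(i < k) #|F i u|.
  have [lt|ge] := ltnP #|X u :&: Y u| k; first by rewrite (leq_trans (ltnW lt)) ?leq_addr.
  suff /free/orP[|lt] : {in above u, forall v, X u :&: Y u \subset X v :&: Y v}.
  - by rewrite ltnNge ge.
  - by rewrite (bigD1 (Ordinal lt)) //= {1}/F eqxx addnCA leq_addr.
  - by move=> v; rewrite inE => /andP[sX sY]; exact: setISS.
apply: leq_trans (leq_sum _ (fun u _ => split_u u)) _.
rewrite big_split /= sum_nat_const [#|U| * k]mulnC leq_add2l exchange_big /=.
set bound := h * k * _ + _.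
have -> : k * bound = \sum_(i < k) bound by rewrite sum_nat_const card_ord.
rewrite {}/bound; apply: leq_sum => i _.
apply: (crossing_incidences (F := F i) free lamY _ _ lth) => [u|p u v].
  by rewrite /F; case: ifP => // _; exact: sub0set.
rewrite /F; case: eqP => [ci|_]; last by rewrite inE.
rewrite inE => /andP[pXu pYu]; case: eqP => [cj|_]; last by rewrite inE.
rewrite inE => /andP[pXv pYv] leX.
have meet (A B : {set T}) : p \in A -> p \in B -> [disjoint A & B] = false.
  by move=> pA pB; apply/negbTE/pred0Pn; exists p; rewrite /= pA.
have sX : X u \subset X v.
  have := lamX u v; rewrite (meet _ _ pXu pXv) orbF => /orP[//|sX].
  by have /eqP -> : X v == X u by rewrite eqEcard sX.
split=> //.
have := lamY u v; rewrite (meet _ _ pYu pYv) orbF => /orP[sY|//].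
have /eqP E : above v == above u.
  rewrite eqEcard ci cj leqnn andbT; apply/subsetP => w; rewrite !inE => /andP[sX' sY'].
  by rewrite (subset_trans sX sX') (subset_trans sY sY').
have : u \in above v by rewrite E inE !subxx.
by rewrite inE => /andP[].
Qed.

(** * Digit expansions *)

Definition from_digits (a m : nat) (d : nat -> nat) : nat :=
  \sum_(j < m) d j * a ^ j.

Lemma from_digits_lt (a m : nat) (d : nat -> nat) :
  (forall j, d j < a) -> from_digits a m d < a ^ m.
Proof.
move=> da; rewrite /from_digits; elim: m => [|m IHm]; first by rewrite big_ord0.
rewrite big_ord_recr /= expnS.
by apply: leq_trans (leq_mul (da m) (leqnn _)); rewrite mulSn ltn_add2r.
Qed.

Lemma from_digits_div (a m : nat) (d : nat -> nat) (i : nat) :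
  (forall j, d j < a) -> i <= m ->
  from_digits a m d %/ a ^ i = from_digits a (m - i) (fun j => d (i + j)).
Proof.
move=> da im; have a0 : 0 < a by apply: leq_ltn_trans (da 0).
rewrite -[m in from_digits a m d](subnKC im) {1}/from_digits big_split_ord /= -/(from_digits a i d).
under [X in _ + X]eq_bigr do rewrite expnD mulnCA.
rewrite -big_distrr /= addnC mulnC divnMDl ?expn_gt0 ?a0 //.
by rewrite divn_small ?addn0 // from_digits_lt.
Qed.

Lemma from_digitsK (a m : nat) (d : nat -> nat) (j : nat) :
  (forall j, d j < a) -> j < m -> (from_digits a m d %/ a ^ j) %% a = d j.
Proof.
move=> da jm; rewrite from_digits_div ?(ltnW jm) // -(subnSK jm) /from_digits.
rewrite big_ord_recl addn0 muln1 addnC.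
under eq_bigr do rewrite expnS mulnCA.
by rewrite -big_distrr /= mulnC modnMDl modn_small.
Qed.

(** When [a] is a power of 2, equal quotients mean a common dyadic interval; this turns dyadic
    membership into agreement of leading digits. *)
Lemma from_digits_div_eq (a m : nat) (d d' : nat -> nat) (i : nat) :
  (forall j, d j < a) -> (forall j, d' j < a) -> i <= m ->
  from_digits a m d %/ a ^ i = from_digits a m d' %/ a ^ i <->
  (forall j, i <= j < m -> d j = d' j).
Proof.
move=> da da' im; split=> [eqi j /andP[ij jm]|eqd].
  rewrite -(from_digitsK da jm) -(from_digitsK da' jm) -(subnKC ij) expnD.
  by rewrite !divnMA eqi.
rewrite !from_digits_div //; apply: eq_bigr => j _; rewrite eqd //.
by have := ltn_ord j; lia.
Qed.

Lemma mem_incidences (T : choiceType) (P : {fset T}) (Bs : {fset (set T)}) p B :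
  ((p, B) \in incidences P Bs) = [&& p \in P, B \in Bs & p \in B].
Proof. by rewrite /incidences !(inE, in_fsetE) /= andbA. Qed.

Lemma fset_two (T : choiceType) (X : {fset T}) :
  #|` X| = 2 -> exists p q, [/\ p \in X, q \in X & p != q].
Proof.
move=> c2; have /fset0Pn[p Xp] : X != fset0 by rewrite -cardfs_gt0 c2.
have /fset0Pn[q] : (X `\ p)%fset != fset0.
  by rewrite -cardfs_gt0; have := cardfsD1 p X; rewrite Xp c2; lia.
by rewrite in_fsetD1 => /andP[ne Xq]; exists p, q; rewrite eq_sym.
Qed.

(** * Lower bound: the Hamming grid and its lines as dyadic boxes *)

Section Grid.
Variables (R : realType) (r b : nat).
Hypothesis def_b : 2 ^ r = b.+1.

Local Notation word := {ffun 'I_b.+1 -> 'I_b.+1}.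
Local Notation line := ('I_b.+1 * {ffun 'I_b -> 'I_b.+1})%type.

Definition line_point (l : line) (v : 'I_b.+1) : word :=
  [ffun j => oapp l.2 v (unlift l.1 j)].

Definition on_line (c : word) (l : line) := [forall j, c (lift l.1 j) == l.2 j].

Lemma line_pointP (l : line) (v : 'I_b.+1) : on_line (line_point l v) l.
Proof. by apply/forallP => j; rewrite ffunE liftK. Qed.

Lemma line_point_inj (l : line) : injective (line_point l).
Proof. by move=> v w /ffunP/(_ l.1); rewrite !ffunE unlift_none. Qed.

(** Distinct words on a line differ exactly at its direction, so two lines through both share the
    direction, and the other letters are those of [c]. *)
Lemma line_uniq (c c' : word) (l l' : line) :
  on_line c l -> on_line c l' -> on_line c' l -> on_line c' l' ->
  c != c' -> l = l'.
Proof.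
case: l l' => [i g] [i' g'] /forallP cl /forallP cl' /forallP c'l /forallP c'l' ne.
have [j nej] : exists j, c j != c' j.
  apply/existsP; apply: contraR ne; rewrite negb_exists => /forallP E.
  by apply/eqP/ffunP => j; have /negPn/eqP := E j.
have ij h (h' : {ffun 'I_b -> 'I_b.+1}) : (forall l, c (lift h l) == h' l) ->
    (forall l, c' (lift h l) == h' l) -> h = j.
  move=> e e'; case: (unliftP h j) => [l El|//].
  by move: nej; rewrite El (eqP (e l)) (eqP (e' l)) eqxx.
have Ei : i = j := ij _ _ cl c'l; have Ei' : i' = j := ij _ _ cl' c'l'.
move: cl cl'; rewrite /= Ei Ei' => cl cl'; congr (_, _); apply/ffunP => l.
by rewrite -(eqP (cl l)) -(eqP (cl' l)).
Qed.

Definition xval (c : word) := from_digits b.+1 b.+1 (fun j => c (inord (b - j))).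
Definition yval (c : word) := from_digits b.+1 b.+1 (fun j => c (inord j)).

Local Open Scope ring_scope.

Definition grid_point (c : word) : 'rV[R]_2 :=
  \row_k (if k == ord0 then xval c else yval c)%:R.

(** Since [def_b] makes [2 ^ (r * e)] equal to [b.+1 ^ e], fixing all but the last [e] digits is a
    dyadic condition. *)
Definition dyadic_around (e m : nat) : interval R :=
  let s := (m %/ b.+1 ^ e)%N%:Z in let t := (r * e)%N%:Z in
  `[s%:~R * 2 ^ t, (s + 1)%:~R * 2 ^ t[.

(** The x-side fixes the letters before position [l.1] and the y-side those after it. The letter at
    [l.1] stays free, so any value in place of [ord0] gives the same box. *)
Definition line_box (l : line) : set 'rV[R]_2 :=
  let c := line_point l ord0 in
  itv_prod (fun k => if k == ord0 then dyadic_around (b.+1 - l.1) (xval c)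
                     else dyadic_around l.1.+1 (yval c)).

Lemma mem_dyadic_around (e m n : nat) :
  (n%:R \in dyadic_around e m) = (n %/ b.+1 ^ e == m %/ b.+1 ^ e)%N.
Proof.
rewrite in_itv /= -exprnP -natrX expnM def_b -PoszD addn1 -!pmulrn -!natrM ler_nat ltr_nat.
have b0 : (0 < b.+1 ^ e)%N by rewrite expn_gt0.
by rewrite -leq_divRL // -ltn_divLR // ltnS andbC -eqn_leq.
Qed.

Lemma line_box_dyadic (l : line) : is_dyadic_box (line_box l).
Proof.
eexists; last by [].
by move=> k /=; case: (k == ord0); eexists; eexists.
Qed.

Lemma mem_line_box (c : word) (l : line) :
  (grid_point c \in line_box l) = on_line c l.
Proof.
have coords (k : 'I_2) : grid_point c ord0 k = (if k == ord0 then xval c else yval c)%:R.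
  by rewrite mxE.
pose c0 := line_point l ord0.
have xE := @from_digits_div_eq b.+1 b.+1 (fun j => c (inord (b - j)))
  (fun j => c0 (inord (b - j))) (b.+1 - l.1)
  (fun j => ltn_ord _) (fun j => ltn_ord _) (leq_subr _ _).
have yE := @from_digits_div_eq b.+1 b.+1 (fun j => c (inord j))
  (fun j => c0 (inord j)) l.1.+1 (fun j => ltn_ord _) (fun j => ltn_ord _) (ltn_ord _).
have c0E j : c0 (lift l.1 j) = l.2 j by rewrite ffunE liftK.
apply/idP/idP => [|/forallP onl].
  rewrite in_setE => inb; apply/forallP => j; rewrite -c0E; apply/eqP.
  have := inb ord0; have := inb ord_max; rewrite !coords /= !mem_dyadic_around.
  move=> /eqP/yE ey /eqP/xE ex; set m := lift l.1 j.
  have mb := ltn_ord m; have lb := ltn_ord l.1.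
  have : (m : nat) <> l.1 by move=> /ord_inj E; have := neq_lift l.1 j; rewrite -/m E eqxx.
  case: (ltngtP m l.1) => // lt _; apply/val_inj.
    have := ex (b - m)%N; rewrite subKn ?inord_val //; apply; lia.
  by have := ey m; rewrite inord_val; apply; lia.
have agree j : j != l.1 -> c j = c0 j.
  by case: (unliftP l.1 j) => [m ->|->]; rewrite ?eqxx // c0E => _; apply/eqP.
rewrite in_setE => k; rewrite coords; case: ifP => _; rewrite mem_dyadic_around; apply/eqP.
  apply/xE => j jb; rewrite agree // -val_eqE /= inordK; have := ltn_ord l.1; lia.
apply/yE => j jb; rewrite agree // -val_eqE /= inordK; have := ltn_ord l.1; lia.
Qed.

Lemma grid_point_inj : injective grid_point.
Proof.
move=> c c' /rowP/(_ ord_max); rewrite !mxE /= => /eqP; rewrite eqr_nat => /eqP E.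
have yE := @from_digits_div_eq b.+1 b.+1 (fun j => c (inord j))
  (fun j => c' (inord j)) 0 (fun j => ltn_ord _) (fun j => ltn_ord _) (leq0n _).
apply/ffunP => j; apply/val_inj; rewrite -[j]inord_val; apply yE; last by rewrite ltn_ord.
by rewrite expn0 !divn1.
Qed.

Lemma line_box_inj : (0 < b)%N -> injective line_box.
Proof.
move=> b0 l l' E.
have on v : on_line (line_point l v) l' by rewrite -mem_line_box -E mem_line_box line_pointP.
(* As [b] is positive, [ord0] and [ord_max] give two distinct points of the line. *)
apply: (@line_uniq (line_point l ord0) (line_point l ord_max)) => //; rewrite ?line_pointP //.
by rewrite (inj_eq (@line_point_inj l)) -val_eqE /= eq_sym -lt0n.
Qed.

Definition grid_points : {fset 'rV[R]_2} := [fset grid_point c | c in {: word}]%fset.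
Definition grid_boxes : {fset set 'rV[R]_2} := [fset line_box l | l in {: line}]%fset.

Lemma card_grid_points : #|` grid_points| = (b.+1 ^ b.+1)%N.
Proof.
rewrite card_imfset; last exact: grid_point_inj.
by rewrite -cardE card_ffun !card_ord.
Qed.

Lemma card_grid_boxes : (0 < b)%N -> #|` grid_boxes| = (b.+1 ^ b.+1)%N.
Proof.
move=> b0; rewrite card_imfset; last exact: line_box_inj.
by rewrite -cardE card_prod card_ffun !card_ord -expnS.
Qed.

Lemma card_grid_incidences :
  (0 < b)%N -> (b.+1 * b.+1 ^ b.+1 <= #|` incidences grid_points grid_boxes|)%N.
Proof.
move=> b0.
pose f (e : line * 'I_b.+1) := (grid_point (line_point e.1 e.2), line_box e.1).
have f_inj : injective f.
  move=> [l v] [l' v'] [] /grid_point_inj /= + /(line_box_inj b0) E.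
  by rewrite E => /line_point_inj ->.
have : ([fset f e | e in {: line * 'I_b.+1}] `<=` incidences grid_points grid_boxes)%fset.
  apply/fsubsetP => _ /imfsetP[[l v] _ ->].
  by rewrite mem_incidences mem_line_box line_pointP !in_imfset.
move/fsubset_leq_card; apply: leq_trans.
rewrite card_imfset // -cardE !card_prod card_ffun !card_ord.
by rewrite expnS [leqRHS]mulnC.
Qed.

Lemma grid_free : Kkk_free 2 grid_points grid_boxes (incidences grid_points grid_boxes).
Proof.
move=> [X [Y [sX sY cX cY inc]]].
have [p [p' [Xp Xp' ne]]] := fset_two cX.
have [B [B' [YB YB' /eqP neB]]] := fset_two cY.
apply: neB.
have /imfsetP[c _ Ec] := fsubsetP sX _ Xp.
have /imfsetP[c' _ Ec'] := fsubsetP sX _ Xp'.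
have /imfsetP[l _ El] := fsubsetP sY _ YB.
have /imfsetP[l' _ El'] := fsubsetP sY _ YB'.
have on q D : q \in X -> D \in Y -> q \in D.
  by move=> Xq YD; have := inc _ _ Xq YD; rewrite mem_incidences => /and3P[].
rewrite El El'; congr line_box; apply: (@line_uniq c c').
- by rewrite -mem_line_box -Ec -El on.
- by rewrite -mem_line_box -Ec -El' on.
- by rewrite -mem_line_box -Ec' -El on.
- by rewrite -mem_line_box -Ec' -El' on.
- by apply: contra ne => /eqP E; rewrite Ec Ec' E.
Qed.
End Grid.

(** * Passage from finite sets to finite types *)

Section Incidence.
Variables (T : choiceType) (P : {fset T}) (Bs : {fset (set T)}).

Definition points_in (B : Bs) : {set P} := [set p | val p \in val B].

Lemma card_incidences : #|` incidences P Bs| = \sum_B #|points_in B|.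
Proof.
pose f (e : Bs * P) := (val e.2, val e.1).
have f_inj : injective f by move=> [B p] [B' p'] [] /val_inj -> /val_inj ->.
pose E := [set e : Bs * P | val e.2 \in val e.1].
have -> : incidences P Bs = [fset f e | e in E]%fset.
  apply/fsetP => -[p B]; rewrite mem_incidences; apply/and3P/imfsetP => /=.
    by move=> [Pp BsB pB]; exists ([` BsB]%fset, [` Pp]%fset); rewrite ?inE.
  by move=> [[B' p']] /=; rewrite inE /= => pB [-> ->]; split; rewrite ?valP.
rewrite card_imfset // -cardE -sum1_card /=.
under [RHS]eq_bigr do rewrite -sum1_card.
by rewrite pair_big_dep /=; apply: eq_bigl => -[B p]; rewrite !inE.
Qed.

(** A biclique with at least [k] elements on each side is trimmed to exactly [k]. *)
Lemma biclique_free_points_in (k : nat) :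
  Kkk_free k P Bs (incidences P Bs) -> biclique_free k points_in.
Proof.
move=> free V W sub; rewrite !ltnNge -negb_and; apply/negP => /andP[kV kW]; apply: free.
have take_k (X : choiceType) (S : {fset X}) (A : {set S}) : k <= #|A| ->
    exists S' : {fset X}, [/\ (S' `<=` S)%fset, #|` S'| = k &
      forall x, x \in S' -> exists2 s, s \in A & x = val s].
  move=> kA; exists [fset val s | s in take k (enum A)]%fset; split.
  - by apply/fsubsetP => _ /imfsetP[s _ ->]; exact: valP.
  - rewrite card_imfset; last exact: val_inj.
    rewrite -[RHS](@size_takel k _ (enum A)) -?cardE //; apply/perm_size/uniq_perm.
    + exact: enum_finmem_uniq.
    + exact/take_uniq/enum_uniq.
    + by move=> s; rewrite enum_finmemE.
  - by move=> _ /imfsetP[s /mem_take + ->]; rewrite mem_enum => As; exists s.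
have [X' [sX cX XP]] := take_k _ _ _ kV; have [Y' [sY cY YP]] := take_k _ _ _ kW.
exists X', Y'; split=> // x y Xx Yy.
have [p Vp ->] := XP _ Xx; have [B WB ->] := YP _ Yy.
have := subsetP (sub _ WB) _ Vp; rewrite inE => pB.
by rewrite mem_incidences pB andbT; apply/andP; split; exact: fsvalP.
Qed.
End Incidence.

(** * Logarithm estimates *)

Section Reals.
Variable R : realType.
Local Open Scope ring_scope.

Lemma ln2_ge : 1 / 2 <= ln (2 : R).
Proof.
have := @le_ln1Dx R (- (1 / 2)); rewrite (_ : 1 + - (1 / 2) = 2^-1 :> R); last by lra.
by rewrite lnV ?posrE //; lra.
Qed.

Lemma ln_le_2sqrt (z : R) : 0 < z -> ln z <= 2 * Num.sqrt z.
Proof.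
move=> z0; rewrite -{1}(sqr_sqrtr (ltW z0)) lnXn ?sqrtr_gt0 // mulr2n.
have := @le_ln1Dx R (Num.sqrt z - 1); have : 0 < Num.sqrt z by rewrite sqrtr_gt0.
by rewrite [1 + _]addrC subrK; lra.
Qed.

Definition loglog_ratio (n : nat) : R := ln (100 + n%:R) / ln (ln (100 + n%:R)).

(** With [z = ln (100 + n)] and [L = z / ln z], take [a] just above [sqrt z] and [h] just above
    [2 * L]. Then [ln a] is at least [ln z / 2], so [h * ln a >= z]. Both are at most [4 * L]
    because [1 <= sqrt z <= 2 * L]. *)
Lemma loglog_params (n : nat) : exists a h : nat,
  [/\ (n < a ^ h)%N, a%:R <= 4 * loglog_ratio n, h%:R <= 4 * loglog_ratio n &
      1 <= 4 * loglog_ratio n].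
Proof.
rewrite /loglog_ratio; set N : R := 100 + n%:R; set z := ln N.
have N100 : 100 <= N by rewrite lerDl.
have N0 : 0 < N by lra.
have z1 : 1 < z.
  have : ln 100 <= z by rewrite ler_ln ?posrE //; lra.
  suff : 3 <= ln (100 : R) by lra.
  apply: (@le_trans _ _ (ln (2 ^+ 6))); last by rewrite ler_ln ?posrE //; lra.
  by rewrite lnXn // -[ln _ *+ _]mulr_natl; have := ln2_ge; lra.
have z0 : 0 < z by lra.
have lz0 : 0 < ln z by rewrite ln_gt0.
set s := Num.sqrt z.
have s1 : 1 <= s by rewrite -sqrtr1 ler_sqrt // ltW.
have ss : s * s = z by rewrite -expr2 sqr_sqrtr // ltW.
set L := z / ln z.
have sL : s <= 2 * L.
  rewrite /L mulrA ler_pdivlMr //.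
  by have := ler_wpM2l (le_trans ler01 s1) (ln_le_2sqrt z0); rewrite -/s mulrCA ss.
exists (Num.truncn s).+1, (Num.truncn (2 * L)).+1; split.
- rewrite -(ltr_nat R) natrX; set a := _.+1; set h := _.+1.
  have sa : s < a%:R by exact: truncnS_gt.
  have a0 : 0 < a%:R :> R by lra.
  apply: (@lt_le_trans _ _ N); first by rewrite ltrDr.
  rewrite -ler_ln ?posrE ?exprn_gt0 // lnXn // -/z -[ln _ *+ _]mulr_natl.
  have lns : ln z = 2 * ln s by rewrite -ss lnM ?posrE; lra.
  have -> : z = 2 * L * (ln z / 2) by rewrite /L; field; lra.
  apply: ler_pM; [lra | lra | exact/ltW/truncnS_gt |].
  have : ln s <= ln a%:R by rewrite ler_ln ?posrE; lra.
  lra.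
- rewrite -natr1; have : (Num.truncn s)%:R <= s by rewrite truncn_le; lra.
  lra.
- rewrite -natr1; have : (Num.truncn (2 * L))%:R <= 2 * L by rewrite truncn_le; lra.
  lra.
- lra.
Qed.
End Reals.

(** * Boxes and dyadic intervals in the plane *)

Local Open Scope ring_scope.

Lemma mem_itv_prod2 (R : realType) (I : 'I_2 -> interval R) (p : 'rV[R]_2) :
  (p \in itv_prod I) = (p ord0 ord0 \in I ord0) && (p ord0 ord_max \in I ord_max).
Proof.
apply/idP/andP => [|[p0 p1]]; first by rewrite in_setE => pI; split; exact: pI.
rewrite in_setE => i.
have /orP[/eqP ->|/eqP ->] : (i == ord0) || (i == ord_max) by case: i => -[|[|]].
  exact: p0.
exact: p1.
Qed.

(** In units of the smaller length both intervals have integer ends and the smaller is a single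
    unit, so no end of the larger lies strictly inside it. *)
Lemma dyadic_itv_nested (R : realType) (I J : interval R) :
  is_dyadic_itv I -> is_dyadic_itv J ->
  [\/ {subset I <= J}, {subset J <= I} | forall z, z \in I -> z \notin J].
Proof.
move=> [s [t ->]] [s' [t' ->]].
wlog tt' : s t s' t' / t <= t'.
  move=> H; have [/H//|/ltW/H] := leP t t'.
  move=> /(_ s' s)[||dis]; [by constructor 2|by constructor 1|constructor 3 => z zI].
  by apply/negP => /dis; rewrite zI.
have [m ->] : exists m : nat, t' = t + m%:Z.
  by exists `|t' - t|%N; lia.
have w0 : 0 < (2 : R) ^ t by rewrite exprz_gt0.
have scale (u : int) : u%:~R * 2 ^ (t + m%:Z) = (u * 2 ^+ m)%:~R * 2 ^ t :> R.
  by rewrite expfzDr // -exprnP intrM rmorphXn /= -mulrA [2 ^+ m * _]mulrC.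
have mono (u v : int) : u <= v -> u%:~R * 2 ^ t <= v%:~R * 2 ^ t :> R.
  by move=> uv; rewrite ler_pM2r // ler_int.
have [lo|lo] := leP (s' * 2 ^+ m) s; last first.
  constructor 3 => z; rewrite !in_itv /= !scale => /andP[_ zs].
  have /mono le : s + 1 <= s' * 2 ^+ m by lia.
  by rewrite negb_and -!ltNge (lt_le_trans zs le).
have [hi|hi] := leP (s + 1) ((s' + 1) * 2 ^+ m); last first.
  constructor 3 => z; rewrite !in_itv /= !scale => /andP[sz _].
  have /mono le : (s' + 1) * 2 ^+ m <= s by lia.
  by rewrite negb_and -!leNgt (le_trans le sz) orbT.
constructor 1 => z; rewrite !in_itv /= !scale => /andP[sz zs].
by rewrite (le_trans (mono _ _ lo) sz) (lt_le_trans zs (mono _ _ hi)).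
Qed.

Section Geometry.
Variables (R : realType) (P : {fset 'rV[R]_2}) (Bs : {fset (set 'rV[R]_2)}).
Variable k : nat.
Hypothesis free : Kkk_free k P Bs (incidences P Bs).

Lemma card_box_incidences (h : nat) :
  (forall B, B \in Bs -> is_box B) -> (#|` P| <= 2 ^ h)%N ->
  (#|` incidences P Bs| <= k * (4 * h).+1 * (#|` P| + #|` Bs|))%N.
Proof.
move=> boxes cP.
have /choice[I defI] : forall B : Bs, exists I, val B = itv_prod I.
  by move=> B; have [I] := boxes _ (fsvalP B); exists I.
pose x (p : P) : R := val p ord0 ord0; pose y (p : P) : R := val p ord0 ord_max.
(* Comparing interval bounds treats open, closed and infinite ends uniformly. *)
pose lo (i : interval R) := let: Interval l _ := i in l.
pose hi (i : interval R) := let: Interval _ r := i in r.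
have itvE (i : interval R) z : (z \in i) = (lo i <= BLeft z)%O && (BRight z <= hi i)%O.
  by case: i => l r; rewrite itv_boundlr.
pose L B := [set p | (lo (I B ord0) <= BLeft (x p))%O].
pose D B := [set p | (BRight (x p) <= hi (I B ord0))%O].
pose J B := [set p | y p \in I B ord_max].
rewrite card_incidences !cardfE.
apply: (@box_incidences _ _ _ _ x y k _ L D J) => //; last by rewrite -cardfE.
- exact: biclique_free_points_in.
- by move=> B; apply/setP => p; rewrite !inE defI mem_itv_prod2 itvE.
- by move=> B s t st; rewrite !inE => /le_trans; apply; rewrite ?lteBSide.
- by move=> B s t st; rewrite !inE; apply: le_trans; rewrite ?lteBSide.
- have Jlo p B : p \in J B -> (lo (I B ord_max) <= BLeft (y p))%O.
    by rewrite in_set itvE => /andP[].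
  move=> V p u v /Jlo lu /Jlo lv /=.
  pose up w := [set t in V :&: J w | y p <= y t]; rewrite -/(up u) -/(up v).
  (* Above a point of [J w] only the upper end matters, and upper ends are totally ordered. *)
  have upE w : (lo (I w ord_max) <= BLeft (y p))%O ->
      up w = [set t in V | (y p <= y t) && (BRight (y t) <= hi (I w ord_max))%O].
    move=> lw; rewrite /up; apply/setP => t; rewrite !in_set itvE -!andbA; congr (_ && _).
    by case: (boolP (y p <= y t)) => [yy|_]; rewrite ?andbF // andbT (le_trans lw).
  rewrite (upE _ lu) (upE _ lv).
  have [le|le] := orP (le_total (hi (I u ord_max)) (hi (I v ord_max))); apply/orP; [left|right];
    apply/subsetP => t; rewrite !in_set => /and3P[-> -> /le_trans]; exact.
Qed.

Lemma card_dyadic_incidences (a h : nat) :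
  (forall B, B \in Bs -> is_dyadic_box B) -> (#|` P| < a ^ h)%N ->
  (#|` incidences P Bs| <=
     k * #|` Bs| + k * (h * k * #|` P| + k * a * #|` Bs|))%N.
Proof.
move=> boxes cP.
have /choice[I defI] : forall B : Bs, exists I : 'I_2 -> interval R,
    (forall i, is_dyadic_itv (I i)) /\ val B = itv_prod I.
  by move=> B; have [I] := boxes _ (fsvalP B); exists I.
pose X i (B : Bs) : {set P} := [set p : P | val p ord0 i \in I B i].
have defX B : points_in P B = X ord0 B :&: X ord_max B.
  by apply/setP => p; rewrite !inE (defI B).2 mem_itv_prod2.
have lam i : laminar (X i).
  move=> u v; case: (dyadic_itv_nested ((defI u).1 i) ((defI v).1 i)) => [sub|sub|dis].
  - by apply/or3P/Or31/subsetP => p; rewrite !inE; exact: sub.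
  - by apply/or3P/Or32/subsetP => p; rewrite !inE; exact: sub.
  - apply/or3P/Or33/pred0P => p; rewrite /= !inE; apply/negP => /andP[/dis/negP].
    by [].
rewrite card_incidences !cardfE; under eq_bigr do rewrite defX.
apply: laminar_incidences => //; last by rewrite -cardfE.
have := biclique_free_points_in free.
by move=> H V W sub; apply: H => B WB; rewrite defX sub.
Qed.
End Geometry.

(** * Assembly of the three bounds with explicit constants *)

Theorem mainTheorem1 (R : realType) :
  [/\ (forall k : nat, exists C : R,
        forall (n1 n2 : nat) (P : {fset 'rV[R]_2}) (Bs : {fset (set 'rV[R]_2)}),
          #|` P| = n1 -> #|` Bs| = n2 ->
          (forall B, B \in Bs -> is_box B) ->
          Kkk_free k P Bs (incidences P Bs) ->
          #|` incidences P Bs|%:R <=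
            C * (n1 + n2)%:R * ln (n1 + n2)%:R ^+ 4),
      (forall k : nat, exists C' : R,
        forall (n1 n2 : nat) (P : {fset 'rV[R]_2}) (Bs : {fset (set 'rV[R]_2)}),
          #|` P| = n1 -> #|` Bs| = n2 ->
          (forall B, B \in Bs -> is_dyadic_box B) ->
          Kkk_free k P Bs (incidences P Bs) ->
          #|` incidences P Bs|%:R <=
            C' * (n1 + n2)%:R * (ln (100 + n1%:R) / ln (ln (100 + n1%:R)))) &
      (exists c : R, 0 < c /\
        forall N : nat, exists n : nat, (N <= n)%N /\
        exists (P : {fset 'rV[R]_2}) (Bs : {fset (set 'rV[R]_2)}),
          [/\ #|` P| = n, #|` Bs| = n,
              (forall B, B \in Bs -> is_dyadic_box B),
              Kkk_free 2 P Bs (incidences P Bs) &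
              c * n%:R * (ln n%:R / ln (ln n%:R)) <= #|` incidences P Bs|%:R])].
Proof.
split=> [k|k|].
(* With [l = ln n >= 1/2] one has [4 * j + 5 <= 8 * l + 5 <= 18 * l <= 144 * l ^ 4]. *)
- exists (144 * k%:R) => n1 n2 P Bs cP cB boxes free.
  have rhs0 : 0 <= 144 * k%:R * (n1 + n2)%:R * ln (n1 + n2)%:R ^+ 4 :> R.
    by rewrite mulr_ge0 ?exprn_even_ge0 // !mulr_ge0.
  (* Without points or without boxes there are no incidences; otherwise [n >= 2], which keeps [ln n]
     away from 0. *)
  have [n0|] := posnP (n1 * n2).
    suff -> : #|` incidences P Bs| = 0%N by [].
    apply/eqP; rewrite cardfs_eq0; apply/eqP/fsetP => -[p B]; rewrite mem_incidences in_fset0.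
    apply/negP => /and3P[Pp BB _]; move/eqP: n0; rewrite muln_eq0 -cP -cB !cardfs_eq0.
    by move=> /orP[/eqP E|/eqP E]; [rewrite E in Pp|rewrite E in BB].
  rewrite muln_gt0 => /andP[n1_gt0 n2_gt0]; pose j := trunc_log 2 n1.
  have := @card_box_incidences _ _ _ k free j.+1 boxes.
  rewrite cP cB => /(_ (ltnW (@trunc_log_ltn 2 _ isT))); rewrite -(ler_nat R) => /le_trans; apply.
  set n := (n1 + n2)%N; set l := ln n%:R.
  have n2R : 2 <= n%:R :> R by rewrite ler_nat /n; lia.
  have n0R : 0 < n%:R :> R by lra.
  have l2 : 1 / 2 <= l by rewrite (le_trans (ln2_ge R)) // ler_ln ?posrE.
  have jl : j%:R <= 2 * l.
    have : ln (2 ^+ j) <= l.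
      rewrite ler_ln ?posrE ?exprn_gt0 // -natrX ler_nat.
      by rewrite (leq_trans (trunc_logP _ n1_gt0)) // leq_addr.
    rewrite lnXn // -[ln _ *+ _]mulr_natl; have := ln2_ge R; have : 0 <= j%:R :> R by [].
    by move=> j0 ln2; have := ler_wpM2l j0 ln2; lra.
  have l4 : l <= 8 * l ^+ 4.
    have : 1 / 8 <= l ^+ 3 by rewrite (_ : 1 / 8 = (1 / 2) ^+ 3) ?lerXn2r ?nnegrE //; lra.
    by rewrite exprS => l3; have := ler_wpM2l (_ : 0 <= l) l3; lra.
  have -> : (k * (4 * j.+1).+1 * n = k * n * (4 * j + 5))%N by lia.
  have kn0 : 0 <= k%:R * n%:R :> R by rewrite mulr_ge0.
  apply: (@le_trans _ _ (k%:R * n%:R * (144 * l ^+ 4))); last by lra.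
  by rewrite natrM [(k * n)%:R]natrM ler_wpM2l // natrD natrM; lra.
(* The [k] pays for boxes with few points, [k ^ 2] for the losses in the [k] classes; [4] comes from
   [loglog_params]. *)
- exists (4 * (k%:R + k%:R ^+ 2)) => n1 n2 P Bs cP cB boxes free.
  have [a [h [lt aL hL L1]]] := loglog_params R n1.
  have := @card_dyadic_incidences _ _ _ k free a h boxes.
  rewrite cP cB => /(_ lt); rewrite -(ler_nat R) => /le_trans; apply.
  rewrite -/(loglog_ratio R n1); set L := loglog_ratio R n1 in aL hL L1 *.
  have K0 : 0 <= k%:R :> R by []; have A1 : 0 <= n1%:R :> R by []; have A2 : 0 <= n2%:R :> R by [].
  rewrite !(natrD, natrM).
  have e1 := ler_wpM2l (mulr_ge0 K0 A2) L1.
  have e2 := ler_wpM2l (mulr_ge0 (mulr_ge0 K0 K0) A1) hL.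
  have e3 := ler_wpM2l (mulr_ge0 (mulr_ge0 K0 K0) A2) aL.
  have e4 : 0 <= k%:R * n1%:R * (4 * L) by apply: mulr_ge0; [exact: mulr_ge0 | lra].
  lra.
(* For [n = a ^ a] the ratio is [a * ln a / (ln a + ln (ln a))], at most [a] once [ln a >= 1], and
   the grid has at least [a * n] incidences. *)
- exists 1; split=> // N.
  have [r [b [Nb def_b b3]]] : exists r b, [/\ (N <= b)%N, (2 ^ r = b.+1)%N & (3 <= b)%N].
    (* The shift by 2 makes the base at least 4, whose logarithm is at least 1. *)
    exists N.+2, (2 ^ N.+2).-1; have : (N < 2 ^ N)%N by exact: ltn_expl.
    by rewrite !expnS; split; lia.
  have b0 : (0 < b)%N by apply: leq_trans b3.
  exists (b.+1 ^ b.+1)%N; split.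
    apply: (leq_trans Nb); apply: (@leq_trans b.+1); first exact: leqnSn.
    by rewrite expnS leq_pmulr // expn_gt0.
  exists (grid_points R b), (grid_boxes R r b); split.
  + exact: card_grid_points.
  + exact: card_grid_boxes.
  + by move=> B /imfsetP[l _ ->]; exact: line_box_dyadic.
  + exact: grid_free.
  have := card_grid_incidences R def_b b0; rewrite -(ler_nat R); apply: le_trans.
  set a := b.+1; rewrite mul1r natrM mulrC ler_wpM2r //.
  have a4 : 4 <= a%:R :> R by rewrite ler_nat.
  have lna : 1 <= ln (a%:R : R).
    apply: (@le_trans _ _ (ln (2 ^+ 2))); last by rewrite ler_ln ?posrE //; lra.
    by rewrite lnXn // -[ln _ *+ _]mulr_natl; have := ln2_ge R; lra.
  rewrite natrX lnXn ?ltr0n // -[ln _ *+ _]mulr_natl lnM ?posrE ?ltr0n //; last by lra.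
  have : 0 <= ln (ln (a%:R : R)) by rewrite ln_ge0.
  move=> ll; rewrite ler_pdivrMr; last by lra.
  by rewrite ler_pM2l ?ltr0n //; lra.
Qed.
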